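(* Consider the 1D high-order scheme for cell averages $$\bar{\mathbf U}_j^{n+1}=\bar{\mathbf U}_j^n-\frac{\Delta t_n}{\Delta x}\Big(\hat{\mathbf F}_1(\mathbf U_{j+\frac12}^-,\mathbf U_{j+\frac12}^+)-\hat{\mathbf F}_1(\mathbf U_{j-\frac12}^-,\mathbf U_{j-\frac12}^+)\Big),\qquad \mathbf U_{j+\frac12}^-=\mathbf U_j^n(x_{j+\frac12}),\quad \mathbf U_{j+\frac12}^+=\mathbf U_{j+1}^n(x_{j+\frac12}),$$ where $\mathbf U_j^n(x)$ is a polynomial vector of degree $K\ge1$ on the cell $I_j=(x_{j-\frac12},x_{j+\frac12})$ whose average over $I_j$ is $\bar{\mathbf U}_j^n$. If the polynomial vectors $\{\mathbf U_j^n(x)\}$ satisfy $$B_{1,j+\frac12}^\pm=B_{const}\quad\forall j,\qquad\qquad \mathbf U_j^n(\hat x_j^{(\mu)})\in\mathcal G\quad\forall\mu\in\{1,\dots,L\},\ \forall j,$$ (with $B_{const}$ a constant independent of $j$), and the parameter $\alpha_{1,n}^{LF}$ in the LF flux satisfies $$\alpha_{1,n}^{LF}>\max_j\alpha_1(\mathbf U_{j+\frac12}^\pm,\mathbf U_{j-\frac12}^\pm)$$ (the maximum taken over all $j$ and over both choices of the sign, the same sign in both arguments), then the scheme is positivity-preserving, i.e. $\bar{\mathbf U}_j^{n+1}\in\mathcal G$ for all $j$, under the CFL condition $$0<\alpha_{1,n}^{LF}\,\Delta t_n/\Delta x\le\hat\omega_1.$$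
   Context: A state is $\mathbf U=(\rho,\mathbf m,\mathbf B,E)^\top\in\mathbb R^8$ with $\rho,E\in\mathbb R$, $\mathbf m,\mathbf B\in\mathbb R^3$. For $\rho>0$ put $\mathbf v=\mathbf m/\rho$, $\mathcal E(\mathbf U)=E-\frac12\big(\frac{|\mathbf m|^2}{\rho}+|\mathbf B|^2\big)$, $e=\mathcal E(\mathbf U)/\rho$, $p=p(\rho,e)$, $p_{tot}=p+\frac{|\mathbf B|^2}{2}$. The equation of state $p(\rho,e)$ is any function such that, whenever $\rho>0$, one has $e>0\Leftrightarrow p(\rho,e)>0$. Admissible states: $\mathcal G=\{\mathbf U:\rho>0,\ \mathcal E(\mathbf U)>0\}$. Flux: $$\mathbf F_i(\mathbf U)=\big(\rho v_i,\ \rho v_i\mathbf v-B_i\mathbf B+p_{tot}\mathbf e_i,\ v_i\mathbf B-B_i\mathbf v,\ v_i(E+p_{tot})-B_i(\mathbf v\cdot\mathbf B)\big)^\top,$$ with $\mathbf e_i$ the $i$-th standard unit vector of $\mathbb R^3$. LF flux: $\hat{\mathbf F}_1(\mathbf U^-,\mathbf U^+)=\frac12\big(\mathbf F_1(\mathbf U^-)+\mathbf F_1(\mathbf U^+)-\alpha_{1,n}^{LF}(\mathbf U^+-\mathbf U^-)\big)$. For $\mathbf U,\tilde{\mathbf U}\in\mathcal G$, $\alpha_i(\mathbf U,\tilde{\mathbf U})=\min_{\sigma\in\mathbb R}\alpha_i(\mathbf U,\tilde{\mathbf U};\sigma)$ with $$\alpha_i(\mathbf U,\tilde{\mathbf U};\sigma)=\max\big\{|v_i|+\mathscr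 C_i,\ |\tilde v_i|+\tilde{\mathscr C}_i,\ |\sigma v_i+(1-\sigma)\tilde v_i|+\max\{\mathscr C_i,\tilde{\mathscr C}_i\}\big\}+\frac{|\tilde{\mathbf B}-\mathbf B|}{\sqrt2}\sqrt{\frac{\sigma^2}{\rho}+\frac{(1-\sigma)^2}{\tilde\rho}},$$ $$\mathscr C_i=\frac1{\sqrt2}\Big[\mathscr C_s^2+\frac{|\mathbf B|^2}{\rho}+\sqrt{\Big(\mathscr C_s^2+\frac{|\mathbf B|^2}{\rho}\Big)^2-4\frac{\mathscr C_s^2B_i^2}{\rho}}\Big]^{1/2},\qquad \mathscr C_s=\frac{p}{\rho\sqrt{2e}},$$ and $\tilde{\mathscr C}_i$ the same quantity for $\tilde{\mathbf U}$. The mesh is uniform with spacing $\Delta x>0$ and cell index $j\in\mathbb Z$ (maxima over $j$ understood as suprema). $B_{1,j+\frac12}^\pm$ is the first magnetic component of $\mathbf U_{j+\frac12}^\pm$. $\{\hat x_j^{(\mu)}\}_{\mu=1}^L$ are the $L$-point Gauss–Lobatto quadrature nodes in $I_j$ (including both endpoints), with associated weights $\{\hat\omega_\mu\}_{\mu=1}^L$ normalized so that $\sum_\mu\hat\omega_\mu=1$; $L$ is chosen with $2L-3\ge K$, so that the quadrature is exact for polynomials of degree $K$. *)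

(* Defs.v *)
From HB Require Import structures.
From mathcomp Require Import all_boot all_order all_algebra.
From mathcomp Require Import all_classical all_reals all_analysis.
From mathcomp Require Import ring lra.

Set Implicit Arguments.
Unset Strict Implicit.
Unset Printing Implicit Defensive.

Import Order.TTheory GRing.Theory Num.Theory.
Import numFieldNormedType.Exports.

Local Open Scope classical_set_scope.
Local Open Scope ring_scope.

(* Vectors of R^8, split into the blocks (rho, m, B, E).  With coefficients in
   {poly R} this is the type of polynomial vectors. *)
Notation state T := 'rV[T]_(1 + (3 + (3 + 1))).

(* Euclidean structure of R^3; the library norm `|u| on 'rV[R]_3 is the sup norm. *)
Definition dot (R : realType) (u v : 'rV[R]_3) : R := \sum_k u 0 k * v 0 k.
Definition enorm (R : realType) (u : 'rV[R]_3) : R := Num.sqrt (dot u u).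

Definition mk_state (R : realType) (r : R) (m B : 'rV[R]_3) (E : R) : state R :=
  row_mx (const_mx r) (row_mx m (row_mx B (const_mx E))).

Definition density (R : realType) (U : state R) : R := lsubmx U 0 0.
Definition momentum (R : realType) (U : state R) : 'rV[R]_3 := lsubmx (rsubmx U).
Definition magnetic (R : realType) (U : state R) : 'rV[R]_3 :=
  lsubmx (rsubmx (rsubmx U)).
Definition energy (R : realType) (U : state R) : R :=
  rsubmx (rsubmx (rsubmx U)) 0 0.

Definition velocity (R : realType) (U : state R) : 'rV[R]_3 :=
  (density U)^-1 *: momentum U.

Definition internal_energy (R : realType) (U : state R) : R :=
  energy U - 2^-1 * (enorm (momentum U) ^+ 2 / density U + enorm (magnetic U) ^+ 2).

Definition specific_energy (R : realType) (U : state R) : R :=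
  internal_energy U / density U.

Definition admissible (R : realType) : set (state R) :=
  [set U | 0 < density U /\ 0 < internal_energy U].

Definition is_eos (R : realType) (p : R -> R -> R) : Prop :=
  forall rho e : R, 0 < rho -> (0 < e <-> 0 < p rho e).

Definition pressure (R : realType) (p : R -> R -> R) (U : state R) : R :=
  p (density U) (specific_energy U).

Definition total_pressure (R : realType) (p : R -> R -> R) (U : state R) : R :=
  pressure p U + enorm (magnetic U) ^+ 2 / 2.

Definition flux (R : realType) (p : R -> R -> R) (i : 'I_3) (U : state R) : state R :=
  let r := density U in
  let v := velocity U in
  let B := magnetic U in
  let pt := total_pressure p U in
  mk_state
    (r * v 0 i)
    ((r * v 0 i) *: v - B 0 i *: B + pt *: delta_mx 0 i)
    (v 0 i *: B - B 0 i *: v)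
    (v 0 i * (energy U + pt) - B 0 i * dot v B).

(* Lax-Friedrichs numerical flux in the first direction, which is index 0 of 'I_3. *)
Definition lf_flux (R : realType) (p : R -> R -> R) (a : R) (Um Up : state R) :
    state R :=
  2^-1 *: (flux p 0 Um + flux p 0 Up - a *: (Up - Um)).

Definition sound (R : realType) (p : R -> R -> R) (U : state R) : R :=
  pressure p U / (density U * Num.sqrt (2 * specific_energy U)).

Definition fast_speed (R : realType) (p : R -> R -> R) (i : 'I_3) (U : state R) : R :=
  let a2 := sound p U ^+ 2 + enorm (magnetic U) ^+ 2 / density U in
  (Num.sqrt 2)^-1 *
  Num.sqrt (a2 + Num.sqrt (a2 ^+ 2
                  - 4 * (sound p U ^+ 2 * magnetic U 0 i ^+ 2 / density U))).

Definition alpha_sigma (R : realType) (p : R -> R -> R) (i : 'I_3)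
    (U V : state R) (s : R) : R :=
  let u := velocity U 0 i in
  let v := velocity V 0 i in
  let cU := fast_speed p i U in
  let cV := fast_speed p i V in
  Num.max (Num.max (`|u| + cU) (`|v| + cV))
          (`|s * u + (1 - s) * v| + Num.max cU cV)
  + enorm (magnetic V - magnetic U) / Num.sqrt 2
    * Num.sqrt (s ^+ 2 / density U + (1 - s) ^+ 2 / density V).

(* The infimum is a minimum for admissible states: see alpha_attained below. *)
Definition alpha (R : realType) (p : R -> R -> R) (i : 'I_3) (U V : state R) : R :=
  inf (range (alpha_sigma p i U V)).

Definition interval_mean (R : realType) (a b : R) (f : R -> R) : R :=
  (b - a)^-1 * \int[lebesgue_measure]_(x in `[a, b]) f x.

Definition eval_vec (R : realType) (P : state {poly R}) (x : R) : state R :=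
  map_mx (fun q : {poly R} => q.[x]) P.

Definition mean_vec (R : realType) (a b : R) (P : state {poly R}) : state R :=
  map_mx (fun q : {poly R} => interval_mean a b (fun x => q.[x])) P.

(* x 1 < ... < x L and w 1, ..., w L are the nodes and weights of the L-point
   Gauss-Lobatto rule on [a, b]: both endpoints are nodes, and the rule is exact
   up to degree 2L-3, i.e. for polynomials of size at most 2L-2.  It computes the
   mean over [a, b], so that exactness on constants says that the weights sum
   to 1.  Values of x and w outside 1..L are irrelevant. *)
Definition gauss_lobatto (R : realType) (a b : R) (L : nat) (x w : nat -> R) : Prop :=
  [/\ (2 <= L)%N,
      x 1%N = a /\ x L = b,
      forall mu, (1 <= mu < L)%N -> x mu < x mu.+1 &
      forall q : {poly R}, (size q <= 2 * L - 2)%N ->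
        interval_mean a b (fun t => q.[t]) = \sum_(1 <= mu < L.+1) w mu * q.[x mu]].

(* xh j stands for x_{j+1/2}, so that the cell I_j is ]xh (j-1), xh j[, and
   trace xh P s j stands for U^-_{j+1/2} if s = false and U^+_{j+1/2} if s = true. *)
Definition trace (R : realType) (xh : int -> R) (P : int -> state {poly R})
    (s : bool) (j : int) : state R :=
  eval_vec (P (if s then j + 1 else j)) (xh j).

Lemma coercive_min (R : realType) (f : R -> R) (k M : R) :
  0 < k -> continuous f -> (forall s, k * `|s| - M <= f s) ->
  exists s0, forall s, f s0 <= f s.
Proof.
move=> k0 cf fge.
pose r := `|f 0 + M| / k.
have r0 : 0 <= r by rewrite divr_ge0 // ltW.
have [||c _ cmin] := @EVT_min R f (- r) r.
- lra.
- exact: continuous_subspaceT.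
exists c => s; case: (boolP (s \in `[- r, r]%R)) => [/cmin//|].
rewrite in_itv /= -ler_norml -ltNge => rs.
apply: (@le_trans _ _ (f 0)).
  by apply: cmin; rewrite in_itv /=; apply/andP; split; lra.
apply: le_trans (fge s).
have : r * k < `|s| * k by rewrite ltr_pM2r.
rewrite /r divfK ?gt_eqF // => h.
have := ler_norm (f 0 + M); lra.
Qed.

Lemma alpha_sigma_continuous (R : realType) (p : R -> R -> R) (i : 'I_3)
    (U V : state R) :
  continuous (alpha_sigma p i U V).
Proof.
move=> s; rewrite /alpha_sigma.
have cid : (fun t : R => t) x @[x --> s] --> s by exact: cvg_id.
have c1 : (1 - t : R) @[t --> s] --> (1 - s : R).
  by apply: cvgB => //; exact: cvg_cst.
apply: cvgD.
  apply: (@continuous_max _ _ (fun=> _) _ s); first exact: cvg_cst.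
  apply: cvgD; last exact: cvg_cst.
  by apply: cvg_norm; apply: cvgD; apply: cvgMr_tmp.
apply: cvgMl_tmp.
apply: (@continuous_cvg _ _ _ _ _ (fun t : R => _) Num.sqrt); first exact: sqrt_continuous.
by apply: cvgD; apply: cvgMr_tmp; rewrite ?expr2; apply: cvgM.
Qed.

Lemma alpha_attained (R : realType) (p : R -> R -> R) (i : 'I_3) (U V : state R) :
  admissible U -> admissible V ->
  exists s0, alpha p i U V = alpha_sigma p i U V s0 /\
    forall s, alpha p i U V <= alpha_sigma p i U V s.
Proof.
move=> [rU _] [rV _].
suff [s0 s0min] : exists s0, forall s,
    alpha_sigma p i U V s0 <= alpha_sigma p i U V s.
  have E : alpha p i U V = alpha_sigma p i U V s0.
    apply/eqP; rewrite eq_le; apply/andP; split.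
      apply: ge_inf; last by exists s0.
      by exists (alpha_sigma p i U V s0) => _ [s _ <-].
    apply: lb_le_inf; first by exists (alpha_sigma p i U V s0), s0.
    by move=> _ [s _ <-].
  by exists s0; rewrite E.
have cont := @alpha_sigma_continuous R p i U V.
pose u := velocity U 0 i; pose v := velocity V 0 i.
pose d := enorm (magnetic V - magnetic U) / Num.sqrt 2.
have d0 : 0 <= d by rewrite divr_ge0 ?sqrtr_ge0.
have cge0 W : 0 <= fast_speed p i W by rewrite mulr_ge0 ?invr_ge0 ?sqrtr_ge0.
have max0 : 0 <= Num.max (fast_speed p i U) (fast_speed p i V).
  by rewrite le_max cge0.
have lb s : `|s * u + (1 - s) * v|
    + d * Num.sqrt (s ^+ 2 / density U + (1 - s) ^+ 2 / density V)
    <= alpha_sigma p i U V s.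
  rewrite /alpha_sigma -/u -/v -/d lerD2r le_max; apply/orP; right; lra.
have [uv|uv] := eqVneq u v; last first.
  apply: (@coercive_min _ _ `|u - v| `|v|) => // [|s].
    by rewrite normr_gt0 subr_eq0.
  apply: le_trans (lb s).
  have -> : s * u + (1 - s) * v = (u - v) * s + v by ring.
  have := lerB_dist ((u - v) * s) (- v); rewrite opprK normrN normrM => h.
  have := mulr_ge0 d0 (sqrtr_ge0 (s ^+ 2 / density U + (1 - s) ^+ 2 / density V)).
  lra.
have [dz|dn0] := eqVneq d 0.
  exists 0 => s; rewrite /alpha_sigma -/u -/v -/d dz !mul0r !addr0 !add0r.
  by rewrite uv subr0 mul1r -mulrDl subrKC mul1r.
apply: (@coercive_min _ _ (d / Num.sqrt (density U)) 0) => // [|s].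
  by rewrite divr_gt0 ?sqrtr_gt0 // lt_def dn0.
apply: le_trans (lb s); rewrite subr0 -[leLHS]add0r lerD //.
rewrite -mulrA ler_wpM2l // mulrC -sqrtr_sqr -sqrtrV ?(ltW rU) //.
rewrite -sqrtrM ?sqr_ge0 // ler_wsqrtr // lerDl divr_ge0 ?sqr_ge0 //.
exact: ltW.
Qed.

(* Main.v *)
Require Import Defs.
From HB Require Import structures.
From mathcomp Require Import all_boot all_order all_algebra.
From mathcomp Require Import all_classical all_reals all_analysis.
From mathcomp Require Import ring lra zify.

(** A state is admissible exactly when its density is positive and a family of
    affine functionals, indexed by a test velocity [v] and a test magnetic field
    [B], is positive at it ([admissibleP]): completing squares, such a functional
    is the internal energy plus the kinetic and magnetic energies relative to
    [v] and [B].  Hence admissible states are stable under convex combinations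
    ([admissible_convex_sum]), and the theorem follows once the updated average
    is written as a convex combination of admissible states.

    The average over the cell is the Gauss-Lobatto sum of nodal values, whose
    two extreme nodes carry the traces entering the numerical fluxes.  Taking
    from each extreme weight the amount [aLF * dt / dx] and regrouping the
    fluxes by the sign of the traces ([lf_regroup]), what is not a nodal value
    becomes two Lax-Friedrichs splittings
    [(U - F U / a + V + F V / a) / 2], where [U] and [V] are traces of the same
    sign at the right and left ends of the cell.  The coefficients are
    nonnegative because the interior weights are positive
    ([gauss_lobatto_weight_gt0]) and the two extreme ones are equal
    ([gauss_lobatto_end_weights]), so that the CFL bound on the first applies to
    both.

    It remains to see that a splitting is admissible when [a] exceeds the wave
    speed bound and [U], [V] have the same normal magnetic component
    ([lf_splitting]).  The flux evaluated at a test functional is the sum of four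
    kinds of terms ([test_flux]): advection of the internal energy and of the
    relative kinetic energy; a bilinear form coupling the relative velocity to
    the pressure and the relative magnetic field, bounded by the fast speed
    times the relative energy ([wave_bound]); the test velocity times the
    relative magnetic energy; and terms depending on the state through the
    normal magnetic component only, which cancel between [U] and [V].  The third
    kind has no bound linear in the relative energy of one state, but in the
    difference of its values at [U] and [V] the test velocity can be replaced
    by an average velocity of [U] and [V], with an error proportional to the
    jump of the magnetic field ([magnetic_jump_bound]).  These bounds add up to
    the wave speed bound. *)

Import Order.TTheory GRing.Theory Num.Theory.
Import numFieldNormedType.Exports.

Local Open Scope classical_set_scope.
Local Open Scope ring_scope.

Set Implicit Arguments.
Unset Strict Implicit.
Unset Printing Implicit Defensive.

(** * Euclidean structure of R^3 *)

Lemma dotE (R : realType) (u v : 'rV[R]_3) :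
  dot u v = u 0 0 * v 0 0 + u 0 1 * v 0 1 + u 0 2 * v 0 2.
Proof.
rewrite /dot !big_ord_recl big_ord0 addr0 addrA.
have -> : lift ord0 ord0 = 1 :> 'I_3 by apply/val_inj.
by have -> : lift ord0 (lift ord0 ord0) = 2 :> 'I_3 by apply/val_inj.
Qed.

Lemma dotC (R : realType) (u v : 'rV[R]_3) : dot u v = dot v u.
Proof. by apply: eq_bigr => k _; rewrite mulrC. Qed.

Lemma dotDr (R : realType) (u v v' : 'rV[R]_3) :
  dot u (v + v') = dot u v + dot u v'.
Proof. by rewrite !dotE !mxE; ring. Qed.

Lemma dotZr (R : realType) (c : R) (u v : 'rV[R]_3) :
  dot u (c *: v) = c * dot u v.
Proof. by rewrite !dotE !mxE; ring. Qed.

Lemma dotNr (R : realType) (u v : 'rV[R]_3) : dot u (- v) = - dot u v.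
Proof. by rewrite -scaleN1r dotZr mulN1r. Qed.

Lemma dotDl (R : realType) (u u' v : 'rV[R]_3) :
  dot (u + u') v = dot u v + dot u' v.
Proof. by rewrite dotC dotDr !(dotC v). Qed.

Lemma dotZl (R : realType) (c : R) (u v : 'rV[R]_3) :
  dot (c *: u) v = c * dot u v.
Proof. by rewrite dotC dotZr dotC. Qed.

Lemma dotNl (R : realType) (u v : 'rV[R]_3) : dot (- u) v = - dot u v.
Proof. by rewrite dotC dotNr dotC. Qed.

Definition dot_linear := (dotDl, dotDr, dotZl, dotZr, dotNl, dotNr).

Lemma dot_delta (R : realType) (u : 'rV[R]_3) (i : 'I_3) :
  dot u (delta_mx 0 i) = u 0 i.
Proof.
rewrite /dot (bigD1 i) //= mxE !eqxx mulr1 big1 ?addr0 // => k /negPf ki.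
by rewrite mxE ki mulr0.
Qed.

Lemma dot_ge0 (R : realType) (u : 'rV[R]_3) : 0 <= dot u u.
Proof. by apply: sumr_ge0 => k _; rewrite -expr2 sqr_ge0. Qed.

Lemma enorm_sqr (R : realType) (u : 'rV[R]_3) : enorm u ^+ 2 = dot u u.
Proof. by rewrite sqr_sqrtr // dot_ge0. Qed.

Lemma sqr_coord_le_dot (R : realType) (u : 'rV[R]_3) (i : 'I_3) :
  u 0 i ^+ 2 <= dot u u.
Proof.
by rewrite /dot (bigD1 i) //= expr2 lerDl sumr_ge0 // => k _; rewrite -expr2 sqr_ge0.
Qed.

Lemma ord3P (P : 'I_3 -> Prop) : P 0 -> P 1 -> P 2 -> forall i, P i.
Proof.
move=> P0 P1 P2 [[|[|[|//]]] h].
- by have -> : Ordinal h = 0 by apply/val_inj.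
- by have -> : Ordinal h = 1 by apply/val_inj.
- by have -> : Ordinal h = 2 by apply/val_inj.
Qed.

Lemma dot_sqr_le (R : realType) (u v : 'rV[R]_3) :
  dot u v ^+ 2 <= dot u u * dot v v.
Proof.
rewrite -subr_ge0 !dotE.
set x := (X in 0 <= X).
have -> : x = (u 0 0 * v 0 1 - u 0 1 * v 0 0) ^+ 2
  + (u 0 1 * v 0 2 - u 0 2 * v 0 1) ^+ 2
  + (u 0 2 * v 0 0 - u 0 0 * v 0 2) ^+ 2 by rewrite /x; ring.
by rewrite !addr_ge0 ?sqr_ge0.
Qed.

(** Cauchy-Schwarz in the plane orthogonal to the [i]-th axis. *)
Lemma dot_transverse_sqr_le (R : realType) (u v : 'rV[R]_3) (i : 'I_3) :
  (dot u v - u 0 i * v 0 i) ^+ 2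
  <= (dot u u - u 0 i ^+ 2) * (dot v v - v 0 i ^+ 2).
Proof.
have plane (a b c d : R) :
    (a * b + c * d) ^+ 2 <= (a ^+ 2 + c ^+ 2) * (b ^+ 2 + d ^+ 2).
  rewrite -subr_ge0.
  have -> : (a ^+ 2 + c ^+ 2) * (b ^+ 2 + d ^+ 2) - (a * b + c * d) ^+ 2
    = (a * d - c * b) ^+ 2 by ring.
  exact: sqr_ge0.
elim/ord3P: i; rewrite !dotE.
- by have := plane (u 0 1) (v 0 1) (u 0 2) (v 0 2); congr (_ <= _); ring.
- by have := plane (u 0 0) (v 0 0) (u 0 2) (v 0 2); congr (_ <= _); ring.
- by have := plane (u 0 0) (v 0 0) (u 0 1) (v 0 1); congr (_ <= _); ring.
Qed.

(** * Admissible states as an intersection of half-spaces *)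

(** The linear functional [U |-> U . n] with [n = (|v|^2 / 2, - v, - B, 1)], a
    normal to the boundary of the set of admissible states at the boundary
    states of velocity [v] and magnetic field [B]. *)
Definition test (R : realType) (v B : 'rV[R]_3) (U : state R) : R :=
  energy U - dot v (momentum U) + dot v v / 2 * density U - dot B (magnetic U).

Lemma densityD (R : realType) (U V : state R) :
  density (U + V) = density U + density V.
Proof. by rewrite /density raddfD mxE. Qed.

Lemma densityZ (R : realType) (c : R) (U : state R) :
  density (c *: U) = c * density U.
Proof. by rewrite /density linearZ mxE. Qed.

Lemma momentumD (R : realType) (U V : state R) :
  momentum (U + V) = momentum U + momentum V.
Proof. by rewrite /momentum !raddfD. Qed.

Lemma momentumZ (R : realType) (c : R) (U : state R) :
  momentum (c *: U) = c *: momentum U.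
Proof. by rewrite /momentum !linearZ. Qed.

Lemma magneticD (R : realType) (U V : state R) :
  magnetic (U + V) = magnetic U + magnetic V.
Proof. by rewrite /magnetic !raddfD. Qed.

Lemma magneticZ (R : realType) (c : R) (U : state R) :
  magnetic (c *: U) = c *: magnetic U.
Proof. by rewrite /magnetic !linearZ. Qed.

Lemma energyD (R : realType) (U V : state R) :
  energy (U + V) = energy U + energy V.
Proof. by rewrite /energy !raddfD mxE. Qed.

Lemma energyZ (R : realType) (c : R) (U : state R) :
  energy (c *: U) = c * energy U.
Proof. by rewrite /energy !linearZ mxE. Qed.

Lemma testD (R : realType) (v B : 'rV[R]_3) (U V : state R) :
  test v B (U + V) = test v B U + test v B V.
Proof.
by rewrite /test densityD momentumD magneticD energyD !dotDr; ring.
Qed.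

Lemma testZ (R : realType) (v B : 'rV[R]_3) (c : R) (U : state R) :
  test v B (c *: U) = c * test v B U.
Proof.
by rewrite /test densityZ momentumZ magneticZ energyZ !dotZr; ring.
Qed.

Lemma internal_energyE (R : realType) (U : state R) : 0 < density U ->
  internal_energy U = energy U
    - 2^-1 * (density U * dot (velocity U) (velocity U)
              + dot (magnetic U) (magnetic U)).
Proof.
move=> /gt_eqF/negbT r0; rewrite /internal_energy !enorm_sqr /velocity.
by rewrite !dot_linear; field.
Qed.

Lemma momentumE (R : realType) (U : state R) : 0 < density U ->
  momentum U = density U *: velocity U.
Proof. by move=> /gt_eqF/negbT r0; rewrite scalerA divff // scale1r. Qed.

(** Completing the square in the velocity and in the magnetic field. *)
Lemma test_squares (R : realType) (v B : 'rV[R]_3) (U : state R) :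
  0 < density U ->
  test v B U + dot B B / 2 = internal_energy U
    + density U * dot (velocity U - v) (velocity U - v) / 2
    + dot (magnetic U - B) (magnetic U - B) / 2.
Proof.
move=> r0; rewrite internal_energyE // /test momentumE //.
move: (velocity U) => u.
by rewrite !dot_linear (dotC u v) (dotC (magnetic U) B); field.
Qed.

(** The nonlinear constraint on the internal energy is a family of affine
    ones: the left-hand side of [test_squares] is smallest when the test
    fields are the velocity and the magnetic field of [U] itself, and there it
    equals the internal energy. *)
Lemma admissibleP (R : realType) (U : state R) :
  admissible U <->
  0 < density U /\ forall v B, 0 < test v B U + dot B B / 2.
Proof.
split=> [[r0 e0]|[r0 tU]]; split=> //.
  move=> v B; rewrite test_squares // -addrA ltr_wpDr // addr_ge0 //.
    by rewrite divr_ge0 // mulr_ge0 ?dot_ge0 // ltW.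
  by rewrite divr_ge0 ?dot_ge0.
have := tU (velocity U) (magnetic U); rewrite test_squares // !subrr.
by rewrite !dotE !mxE !mulr0 !addr0 mulr0 mul0r !addr0.
Qed.

Lemma admissible_convex_sum (R : realType) (I : eqType) (r : seq I)
    (c : I -> R) (V : I -> state R) :
  (forall i, i \in r -> 0 <= c i) -> \sum_(i <- r) c i = 1 ->
  (forall i, i \in r -> admissible (V i)) ->
  admissible (\sum_(i <- r) c i *: V i).
Proof.
move=> c0 c1 GV.
have pos (f : I -> R) : (forall i, i \in r -> 0 < f i) ->
    0 < \sum_(i <- r) c i * f i.
  move=> f0.
  have cf i : i \in r -> 0 <= c i * f i.
    by move=> ir; rewrite mulr_ge0 ?c0 ?ltW ?f0.
  rewrite lt_def big_seq sumr_ge0 // andbT psumr_neq0 //.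
  apply/negP => /negP/hasPn none; move/eqP: c1; rewrite big_seq big1.
    by rewrite eq_sym oner_eq0.
  move=> i ir; apply/eqP; have := none _ ir.
  rewrite ir /= lt_def cf // andbT negbK mulf_eq0.
  by rewrite (gt_eqF (f0 _ ir)) orbF.
have lin (f : state R -> R) : {morph f : U W / U + W} ->
    (forall a U, f (a *: U) = a * f U) ->
    f (\sum_(i <- r) c i *: V i) = \sum_(i <- r) c i * f (V i).
  move=> fD fZ; rewrite (big_morph f fD (_ : _ = 0)).
    by apply: eq_bigr => i _; rewrite fZ.
  by rewrite -(scale0r 0) fZ mul0r.
apply/admissibleP; split.
  rewrite (lin (@density R) (@densityD R) (@densityZ R)).
  by apply: pos => i /GV[].
move=> v B; rewrite (lin _ (testD v B) (testZ v B)).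
have -> : dot B B / 2 = \sum_(i <- r) c i * (dot B B / 2).
  by rewrite -mulr_suml c1 mul1r.
rewrite -big_split /= (eq_bigr _ (fun i _ => esym (mulrDr _ _ _))).
by apply: pos => i /GV/admissibleP[].
Qed.

(** * The fast magneto-acoustic speed *)

Lemma normr_le_of_sqr (R : realType) (a d z : R) :
  0 <= a -> 0 <= d -> z ^+ 2 <= a * d -> 2 * `|z| <= a + d.
Proof.
move=> a0 d0 zad; rewrite -ler_sqr ?nnegrE ?mulr_ge0 ?addr_ge0 //.
rewrite exprMn real_normK ?num_real //.
by have := sqr_ge0 (a - d); lra.
Qed.

Lemma fast_speed_ge0 (R : realType) (p : R -> R -> R) (i : 'I_3) (U : state R) :
  0 <= fast_speed p i U.
Proof. by rewrite mulr_ge0 ?invr_ge0 ?sqrtr_ge0. Qed.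

(** The squared fast speed is the larger root of a quadratic equation, the
    characteristic equation of the quadratic form bounded in [wave_form_le]. *)
Lemma fast_speed_root (R : realType) (p : R -> R -> R) (i : 'I_3) (U : state R) :
  0 < density U ->
  let l := fast_speed p i U ^+ 2 in
  let a2 := sound p U ^+ 2 + dot (magnetic U) (magnetic U) / density U in
  l ^+ 2 = a2 * l - sound p U ^+ 2 * (magnetic U 0 i ^+ 2 / density U)
  /\ a2 <= 2 * l.
Proof.
move=> r0 /=; rewrite /fast_speed enorm_sqr.
set S := sound p U ^+ 2; set be := dot _ _ / _.
rewrite -[S * magnetic U 0 i ^+ 2 / _]mulrA; set bi := magnetic U 0 i ^+ 2 / _.
have S0 : 0 <= S by exact: sqr_ge0.
have bi0 : 0 <= bi by rewrite divr_ge0 ?sqr_ge0 // ltW.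
have bibe : bi <= be by rewrite ler_wpM2r ?sqr_coord_le_dot // invr_ge0 ltW.
set disc := (S + be) ^+ 2 - _.
have disc0 : 0 <= disc.
  have -> : disc = (S - be) ^+ 2 + 4 * S * (be - bi) by rewrite /disc; ring.
  by rewrite addr_ge0 ?sqr_ge0 // mulr_ge0 ?subr_ge0 // mulr_ge0.
have d2 := sqr_sqrtr disc0; have d0 := sqrtr_ge0 disc.
have sum0 : 0 <= S + be + Num.sqrt disc by lra.
have -> : ((Num.sqrt 2)^-1 * Num.sqrt (S + be + Num.sqrt disc)) ^+ 2
    = (S + be + Num.sqrt disc) / 2.
  by rewrite exprMn exprVn !sqr_sqrtr // mulrC.
by move: d2; rewrite /disc => d2; split; lra.
Qed.

(** The left-hand side is the squared norm of the covector with which a relative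
    velocity [w] acts on (internal energy, magnetic field) in [wave_bound].  In
    terms of [x = w 0 i] and the norm [y] of the transverse part of [w], the
    right-hand side minus the left-hand side is the density times
    [A x^2 + 2 x z + D y^2] with [z^2 <= A D y^2], where [A D] is computed from
    the characteristic equation and [z] is bounded by Cauchy-Schwarz in the
    transverse plane. *)
Lemma wave_form_le (R : realType) (p : R -> R -> R) (i : 'I_3) (U : state R)
    (w : 'rV[R]_3) : 0 < density U ->
  density U * sound p U ^+ 2 * w 0 i ^+ 2
    + dot (w 0 i *: magnetic U - magnetic U 0 i *: w)
          (w 0 i *: magnetic U - magnetic U 0 i *: w)
  <= fast_speed p i U ^+ 2 * (density U * dot w w).
Proof.
move=> r0; have [+ +] := fast_speed_root p i r0.
set B := magnetic U.
set l := fast_speed p i U ^+ 2; set S := sound p U ^+ 2; set r := density U.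
set wi := w 0 i; set Bi := B 0 i.
set be := dot B B / r; set bi := Bi ^+ 2 / r.
move=> root half.
have r0' : 0 < r := r0.
have rn0 : r != 0 by rewrite gt_eqF.
have bi0 : 0 <= bi by rewrite divr_ge0 ?sqr_ge0 // ltW.
have bibe : bi <= be.
  by rewrite ler_wpM2r ?sqr_coord_le_dot // invr_ge0 ltW.
pose A := l - S - be + bi; pose D := l - bi.
(* both are nonnegative, having a nonnegative product and a nonnegative sum *)
have AD : A * D = bi * (be - bi) by rewrite /A /D; lra.
have AD0 : 0 <= A * D by rewrite AD mulr_ge0 ?subr_ge0.
have sAD : 0 <= A + D by rewrite /A /D; lra.
have A0 : 0 <= A.
  rewrite leNgt; apply/negP => An.
  have : A * D < 0 by rewrite nmulr_rlt0 //; lra.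
  lra.
have D0 : 0 <= D.
  rewrite leNgt; apply/negP => Dn.
  have : A * D < 0 by rewrite nmulr_llt0 //; lra.
  lra.
have y0 : 0 <= dot w w - wi ^+ 2 by rewrite subr_ge0 sqr_coord_le_dot.
pose t := dot w B - wi * Bi.
have tle : t ^+ 2 <= (dot w w - wi ^+ 2) * (dot B B - Bi ^+ 2).
  exact: dot_transverse_sqr_le.
have H : 2 * `|wi * (Bi * t / r)| <= A * wi ^+ 2 + D * (dot w w - wi ^+ 2).
  apply: normr_le_of_sqr.
  - by rewrite mulr_ge0 ?sqr_ge0.
  - by rewrite mulr_ge0.
  - have -> : A * wi ^+ 2 * (D * (dot w w - wi ^+ 2))
      = wi ^+ 2 * (bi / r * ((dot w w - wi ^+ 2) * (dot B B - Bi ^+ 2))).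
      have -> : A * wi ^+ 2 * (D * (dot w w - wi ^+ 2))
        = A * D * (wi ^+ 2 * (dot w w - wi ^+ 2)) by ring.
      by rewrite AD /be /bi; field.
    have -> : (wi * (Bi * t / r)) ^+ 2 = wi ^+ 2 * (bi / r * t ^+ 2).
      by rewrite /bi; field.
    by rewrite ler_wpM2l ?sqr_ge0 // ler_wpM2l // divr_ge0 // ltW.
have {}H : 0 <= A * wi ^+ 2 + D * (dot w w - wi ^+ 2) + 2 * (wi * (Bi * t / r)).
  have := ler_norm (- (wi * (Bi * t / r))); rewrite normrN; lra.
rewrite -subr_ge0 !dot_linear (dotC B w).
set x := (X in 0 <= X).
suff -> : x = r * (A * wi ^+ 2 + D * (dot w w - wi ^+ 2)
                   + 2 * (wi * (Bi * t / r))) by rewrite mulr_ge0 // ltW.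
by rewrite /x /A /D /t /be /bi; field.
Qed.

(** The fast speed is the norm of the bilinear form on the left, once the
    velocity is scaled by the square root of the density and the internal energy
    is replaced by its square root; Young's inequality turns the product of norms
    into the relative energy. *)
Lemma wave_bound (R : realType) (p : R -> R -> R) (i : 'I_3) (U : state R)
    (w b : 'rV[R]_3) : admissible U ->
  `|w 0 i * pressure p U + w 0 i * dot b (magnetic U)
    - magnetic U 0 i * dot w b|
  <= fast_speed p i U * (internal_energy U + density U * dot w w / 2
                         + dot b b / 2).
Proof.
move=> [r0 e0]; set B := magnetic U; set c := fast_speed p i U.
have c0 : 0 <= c by exact: fast_speed_ge0.
have rn0 : density U != 0 by rewrite gt_eqF.
have en0 : internal_energy U != 0 by rewrite gt_eqF.
pose n := w 0 i *: B - B 0 i *: w.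
have -> : w 0 i * pressure p U + w 0 i * dot b B - B 0 i * dot w b
  = w 0 i * pressure p U + dot b n by rewrite !dot_linear (dotC w b); ring.
set q := w 0 i * pressure p U.
have qE : q ^+ 2 = density U * sound p U ^+ 2 * w 0 i ^+ 2 * (2 * internal_energy U).
  have -> : sound p U ^+ 2
      = pressure p U ^+ 2 / (density U ^+ 2 * (2 * specific_energy U)).
    have se0 : 0 < 2 * specific_energy U by rewrite mulr_gt0 // divr_gt0.
    rewrite /sound -[in RHS](sqr_sqrtr (ltW se0)); field.
    by rewrite rn0 gt_eqF // sqrtr_gt0.
  by rewrite /q /specific_energy; field; rewrite rn0.
have nn0 := dot_ge0 n; have bb0 := dot_ge0 b.
have bn := dot_sqr_le b n.
set k := density U * sound p U ^+ 2 * w 0 i ^+ 2 in qE.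
have k0 : 0 <= k by rewrite mulr_ge0 ?sqr_ge0 // mulr_ge0 ?sqr_ge0 // ltW.
(* Cauchy-Schwarz in R^4 for (sqrt (2 * internal_energy U), b), whose square
   root does not appear once squared *)
have cs : (q + dot b n) ^+ 2 <= (2 * internal_energy U + dot b b) * (k + dot n n).
  have e1 : 0 <= internal_energy U by exact: ltW.
  have h : 2 * `|q * dot b n| <= k * dot b b + 2 * internal_energy U * dot n n.
    apply: normr_le_of_sqr.
    - by rewrite mulr_ge0.
    - by rewrite mulr_ge0 // mulr_ge0.
    rewrite exprMn qE.
    rewrite [leRHS](_ : _ = k * (2 * internal_energy U) * (dot b b * dot n n)).
      by rewrite ler_wpM2l // mulr_ge0 // mulr_ge0.
    by ring.
  have := ler_norm (q * dot b n); lra.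
have wf := wave_form_le p i w r0; rewrite -/B -/n -/k -/c in wf.
have ww0 := dot_ge0 w.
suff : 2 * `|q + dot b n| <= c * (2 * internal_energy U + dot b b)
                             + c * (density U * dot w w) by lra.
apply: normr_le_of_sqr.
- by rewrite mulr_ge0 // addr_ge0 // mulr_ge0 // ltW.
- by rewrite mulr_ge0 // mulr_ge0 // ltW.
- apply: le_trans cs _.
  rewrite [leRHS](_ : _ = (2 * internal_energy U + dot b b)
      * (c ^+ 2 * (density U * dot w w))); last by ring.
  by rewrite ler_wpM2l // addr_ge0 // mulr_ge0 // ltW.
Qed.

(** * Lax-Friedrichs splitting *)

Lemma density_mk (R : realType) (r : R) (m B : 'rV[R]_3) (E : R) :
  density (mk_state r m B E) = r.
Proof. by rewrite /density /mk_state row_mxKl mxE. Qed.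

Lemma momentum_mk (R : realType) (r : R) (m B : 'rV[R]_3) (E : R) :
  momentum (mk_state r m B E) = m.
Proof. by rewrite /momentum /mk_state row_mxKr row_mxKl. Qed.

Lemma magnetic_mk (R : realType) (r : R) (m B : 'rV[R]_3) (E : R) :
  magnetic (mk_state r m B E) = B.
Proof. by rewrite /magnetic /mk_state !row_mxKr row_mxKl. Qed.

Lemma energy_mk (R : realType) (r : R) (m B : 'rV[R]_3) (E : R) :
  energy (mk_state r m B E) = E.
Proof. by rewrite /energy /mk_state !row_mxKr mxE. Qed.

Lemma density_flux (R : realType) (p : R -> R -> R) (i : 'I_3) (U : state R) :
  density (flux p i U) = density U * velocity U 0 i.
Proof. by rewrite /flux density_mk. Qed.

(** The last two terms depend on [U] through the normal magnetic component only
    and cancel in a difference of fluxes.  The other cubic term, in the second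
    line, is carried by the test velocity and not by the velocity of [U]. *)
Lemma test_flux (R : realType) (p : R -> R -> R) (i : 'I_3) (U : state R)
    (v B : 'rV[R]_3) : 0 < density U ->
  let w := velocity U - v in
  let b := magnetic U - B in
  test v B (flux p i U)
  = velocity U 0 i * (internal_energy U + density U * dot w w / 2)
    + v 0 i * (dot b b / 2)
    + (w 0 i * pressure p U + w 0 i * dot b (magnetic U)
       - magnetic U 0 i * dot w b)
    - v 0 i * (dot B B / 2) + magnetic U 0 i * dot v B.
Proof.
move=> r0 /=; rewrite internal_energyE // /test /flux.
rewrite density_mk momentum_mk magnetic_mk energy_mk.
rewrite /total_pressure enorm_sqr.
move: (velocity U) (magnetic U) => u BU.
rewrite !dot_linear dot_delta !mxE ?(dotC u v) ?(dotC BU u) ?(dotC BU v).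
by rewrite ?(dotC BU B) ?(dotC B u) ?(dotC B v); field.
Qed.

(** The magnetic energies relative to the test field differ by a term linear in
    [BV - BU]; Young's inequality weighs it with the relative kinetic energies,
    which control the combination [s *: wU + (1 - s) *: wV]. *)
Lemma magnetic_jump_bound (R : realType) (i : 'I_3) (s rU rV : R)
    (wU wV bU bV : 'rV[R]_3) : 0 < rU -> 0 < rV ->
  `|(s * wU 0 i + (1 - s) * wV 0 i) * (dot bU bU / 2 - dot bV bV / 2)|
  <= enorm (bV - bU) / Num.sqrt 2 * Num.sqrt (s ^+ 2 / rU + (1 - s) ^+ 2 / rV)
     * (rU * dot wU wU / 2 + dot bU bU / 2
        + (rV * dot wV wV / 2 + dot bV bV / 2)).
Proof.
move=> rU0 rV0.
set d := enorm _ / _; set S := Num.sqrt _.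
have d0 : 0 <= d by rewrite divr_ge0 ?sqrtr_ge0.
have S0 : 0 <= S by exact: sqrtr_ge0.
have d2 : 2 * d ^+ 2 = dot (bV - bU) (bV - bU).
  by rewrite expr_div_n enorm_sqr sqr_sqrtr //; field.
have S2 : S ^+ 2 = s ^+ 2 / rU + (1 - s) ^+ 2 / rV.
  by rewrite sqr_sqrtr // addr_ge0 // divr_ge0 ?sqr_ge0 // ltW.
set z := (X in `|X|).
have wU0 := dot_ge0 wU; have wV0 := dot_ge0 wV.
have bU0 := dot_ge0 bU; have bV0 := dot_ge0 bV.
set kin := rU * dot wU wU / 2 + rV * dot wV wV / 2.
set mag := dot bU bU / 2 + dot bV bV / 2.
have kin0 : 0 <= kin by rewrite addr_ge0 // divr_ge0 // mulr_ge0 // ltW.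
have mag0 : 0 <= mag by rewrite addr_ge0 // divr_ge0.
have T2 : (s * wU 0 i + (1 - s) * wV 0 i) ^+ 2 <= S ^+ 2 * (2 * kin).
  apply: (@le_trans _ _ (S ^+ 2 * (rU * wU 0 i ^+ 2 + rV * wV 0 i ^+ 2))).
    rewrite -subr_ge0 S2; set x := (X in 0 <= X).
    have -> : x = (s * rV * wV 0 i - (1 - s) * rU * wU 0 i) ^+ 2 / (rU * rV).
      by rewrite /x; field; rewrite !gt_eqF.
    by rewrite divr_ge0 ?sqr_ge0 // mulr_ge0 // ltW.
  rewrite ler_wpM2l ?sqr_ge0 //.
  have -> : 2 * kin = rU * dot wU wU + rV * dot wV wV by rewrite /kin; field.
  by rewrite lerD // ler_wpM2l ?sqr_coord_le_dot // ltW.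
have M2 : (dot bU bU / 2 - dot bV bV / 2) ^+ 2 <= 2 * d ^+ 2 * mag.
  have -> : dot bU bU / 2 - dot bV bV / 2 = - (dot (bV - bU) (bU + bV) / 2).
    by rewrite !dot_linear (dotC bV bU); field.
  rewrite sqrrN d2.
  have h1 := dot_sqr_le (bV - bU) (bU + bV).
  have h2 : dot (bU + bV) (bU + bV) <= 4 * mag.
    have := dot_ge0 (bU - bV); rewrite /mag !dot_linear (dotC bV bU); lra.
  have h3 : dot (bV - bU) (bV - bU) * dot (bU + bV) (bU + bV)
         <= dot (bV - bU) (bV - bU) * (4 * mag).
    by rewrite ler_wpM2l ?dot_ge0.
  by rewrite expr_div_n; lra.
suff : 2 * `|z| <= 2 * (d * S) * kin + 2 * (d * S) * mag.
  by rewrite /kin /mag; lra.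
have dS0 : 0 <= 2 * (d * S) by rewrite mulr_ge0 // mulr_ge0.
apply: normr_le_of_sqr.
- by rewrite mulr_ge0.
- by rewrite mulr_ge0.
rewrite /z exprMn.
rewrite [leRHS](_ : _ = (S ^+ 2 * (2 * kin)) * (2 * d ^+ 2 * mag)); last by ring.
by apply: ler_pM => //; exact: sqr_ge0.
Qed.

(** Generalized Lax-Friedrichs splitting. A single [U - a^-1 *: flux U] need
    not be admissible, since its test value contains the unbounded terms of
    [test_flux]; in the sum of two such states with equal normal magnetic
    component these cancel. What remains of the cubic terms is the test
    velocity times a difference of magnetic energies; the test velocity is
    replaced by the average velocity with weight [s] at the price of
    [magnetic_jump_bound]. *)
Lemma lf_splitting (R : realType) (p : R -> R -> R) (i : 'I_3)
    (U V : state R) (s a : R) :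
  admissible U -> admissible V -> magnetic U 0 i = magnetic V 0 i ->
  alpha_sigma p i U V s < a ->
  admissible (2^-1 *: (U - a^-1 *: flux p i U + (V + a^-1 *: flux p i V))).
Proof.
move=> GU GV Bi; rewrite /alpha_sigma.
have [rU eU] := GU; have [rV eV] := GV.
set cU := fast_speed p i U; set cV := fast_speed p i V.
set uU := velocity U 0 i; set uV := velocity V 0 i.
set M := Num.max (Num.max _ _) _; set J := _ * Num.sqrt _ => Ma.
have cU0 : 0 <= cU by exact: fast_speed_ge0.
have cV0 : 0 <= cV by exact: fast_speed_ge0.
have J0 : 0 <= J by rewrite mulr_ge0 ?divr_ge0 ?sqrtr_ge0.
have MU : `|uU| + cU <= M by rewrite /M !le_max lexx.
have MV : `|uV| + cV <= M by rewrite /M !le_max lexx orbT.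
have MsU : `|s * uU + (1 - s) * uV| + cU <= M.
  by rewrite /M le_max; apply/orP; right; rewrite lerD2l le_max lexx.
have MsV : `|s * uU + (1 - s) * uV| + cV <= M.
  by rewrite /M le_max; apply/orP; right; rewrite lerD2l le_max lexx orbT.
have nU : `|uU| < a by lra.
have nV : `|uV| < a by lra.
have a0 : 0 < a by exact: le_lt_trans nU.
have an0 : a != 0 by rewrite gt_eqF.
apply/admissibleP; split.
  rewrite densityZ !densityD -scaleNr !densityZ !density_flux -/uU -/uV.
  have -> : 2^-1 * (density U + - a^-1 * (density U * uU)
      + (density V + a^-1 * (density V * uV)))
    = (density U * (a - uU) + density V * (a + uV)) / (2 * a) by field.
  have hU := ler_norm uU; have hV := ler_norm (- uV); rewrite normrN in hV.
  rewrite divr_gt0 ?mulr_gt0 // addr_gt0 // mulr_gt0 //; lra.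
move=> v B; rewrite testZ !testD -scaleNr !testZ.
set FU := test v B (flux p i U); set FV := test v B (flux p i V).
pose XU := test v B U + dot B B / 2; pose XV := test v B V + dot B B / 2.
suff : FU - FV < a * (XU + XV).
  rewrite -subr_gt0 => pos.
  have -> : 2^-1 * (test v B U + - a^-1 * FU + (test v B V + a^-1 * FV))
      + dot B B / 2 = (a * (XU + XV) - (FU - FV)) / (2 * a).
    by rewrite /XU /XV; field.
  by rewrite divr_gt0 // mulr_gt0.
have XU0 : 0 < XU by have /admissibleP[_] := GU; apply.
have XV0 : 0 < XV by have /admissibleP[_] := GV; apply.
apply: (@le_lt_trans _ _ ((M + J) * (XU + XV))); last first.
  by rewrite ltr_pM2r // addr_gt0.
rewrite /FU /FV !test_flux // -/uU -/uV Bi /XU /XV !test_squares //.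
have QU := wave_bound p i (velocity U - v) (magnetic U - B) GU.
have QV := wave_bound p i (velocity V - v) (magnetic V - B) GV.
have JB := magnetic_jump_bound i s (velocity U - v) (velocity V - v)
  (magnetic U - B) (magnetic V - B) rU rV.
rewrite -/cU Bi in QU; rewrite -/cV in QV.
rewrite (_ : magnetic V - B - (magnetic U - B) = magnetic V - magnetic U) in JB;
  last by rewrite opprB addrA subrK.
rewrite -/J in JB.
have coordB (x y : 'rV[R]_3) : (x - y) 0 i = x 0 i - y 0 i by rewrite !mxE.
set q := _ + _ - _ in QU; set q' := _ + _ - _ in QV.
rewrite -/q -/q'.
have kU0 := dot_ge0 (velocity U - v); have kV0 := dot_ge0 (velocity V - v).
have mU0 := dot_ge0 (magnetic U - B); have mV0 := dot_ge0 (magnetic V - B).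
set mU := dot (magnetic U - B) _ / 2 in JB QU *.
set mV := dot (magnetic V - B) _ / 2 in JB QV *.
set KU := _ * dot (velocity U - v) _ / 2 in JB QU *.
set KV := _ * dot (velocity V - v) _ / 2 in JB QV *.
have KU0 : 0 <= KU by rewrite divr_ge0 // mulr_ge0 // ltW.
have KV0 : 0 <= KV by rewrite divr_ge0 // mulr_ge0 // ltW.
have {}mU0 : 0 <= mU by rewrite divr_ge0.
have {}mV0 : 0 <= mV by rewrite divr_ge0.
set us := s * uU + (1 - s) * uV in MsU MsV.
have sE : s * (velocity U - v) 0 i + (1 - s) * (velocity V - v) 0 i = us - v 0 i.
  by rewrite !coordB /us -/uU -/uV; ring.
rewrite sE in JB.
(* each velocity in [M] leaves room for the fast speed of [wave_bound] *)
have bnd (x c y : R) : 0 <= y -> `|x| + c <= M -> x * y <= (M - c) * y.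
  by move=> y0 xc; rewrite ler_wpM2r //; have := ler_norm x; lra.
have nbnd (x c y : R) : 0 <= y -> `|x| + c <= M -> - x * y <= (M - c) * y.
  by move=> y0; rewrite -normrN; exact: bnd.
have b1 : uU * (internal_energy U + KU) <= (M - cU) * (internal_energy U + KU).
  by apply: bnd => //; rewrite addr_ge0 // ltW.
have b2 : - uV * (internal_energy V + KV) <= (M - cV) * (internal_energy V + KV).
  by apply: nbnd => //; rewrite addr_ge0 // ltW.
have b3 := bnd _ _ _ mU0 MsU.
have b4 := nbnd _ _ _ mV0 MsV.
move: QU QV JB; rewrite !ler_norml => /andP[_ QU] /andP[QV _] /andP[JB _].
have JU : 0 <= J * internal_energy U by rewrite mulr_ge0 // ltW.
have JV : 0 <= J * internal_energy V by rewrite mulr_ge0 // ltW.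
lra.
Qed.

(** * Means of polynomials *)

Lemma poly_primitive (R : realType) (q : {poly R}) : exists Q, Q^`() = q.
Proof.
exists (\poly_(k < (size q).+1) (q`_k.-1 / k%:R)); apply/polyP => k.
rewrite coef_deriv coef_poly ltnS /=.
have [kq|qk] := ltnP k (size q); last by rewrite mul0rn nth_default.
by rewrite -[LHS]mulr_natr divfK // pnatr_eq0.
Qed.

Lemma continuous_within_horner (R : realType) (q : {poly R}) (A : set R) :
  {within A, continuous (horner q)}.
Proof. by apply: continuous_subspaceT => t; exact: continuous_horner. Qed.

Definition pmean (R : realType) (a b : R) (q : {poly R}) : R :=
  interval_mean a b (fun x => q.[x]).

Lemma pmean_primitive (R : realType) (a b : R) (q Q : {poly R}) :
  a < b -> Q^`() = q -> pmean a b q = (b - a)^-1 * (Q.[b] - Q.[a]).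
Proof.
move=> ab Qq; rewrite /pmean /interval_mean /Rintegral.
rewrite (@continuous_FTC2 _ (horner q) (horner Q)) //.
- exact: continuous_within_horner.
- split=> [x _||].
  + exact: derivable_horner.
  + by apply: cvg_at_right_filter; exact: continuous_horner.
  + by apply: cvg_at_left_filter; exact: continuous_horner.
- by move=> x _; rewrite -derivE Qq.
Qed.

Lemma pmeanD (R : realType) (a b : R) (p q : {poly R}) : a < b ->
  pmean a b (p + q) = pmean a b p + pmean a b q.
Proof.
move=> ab; have [[P Pp] [Q Qq]] := (poly_primitive p, poly_primitive q).
rewrite (pmean_primitive ab Pp) (pmean_primitive ab Qq).
by rewrite (@pmean_primitive _ _ _ _ (P + Q)) ?derivD ?Pp ?Qq // !hornerE; ring.
Qed.

Lemma pmeanZ (R : realType) (a b c : R) (q : {poly R}) : a < b ->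
  pmean a b (c *: q) = c * pmean a b q.
Proof.
move=> ab; have [Q Qq] := poly_primitive q.
rewrite (pmean_primitive ab Qq).
by rewrite (@pmean_primitive _ _ _ _ (c *: Q)) ?derivZ ?Qq // !hornerZ; ring.
Qed.

(** Substitution of the reflection of [a, b] about its midpoint. *)
Lemma pmean_reflect (R : realType) (a b : R) (q : {poly R}) : a < b ->
  pmean a b (q \Po ((a + b)%:P - 'X)) = pmean a b q.
Proof.
move=> ab; have [Q Qq] := poly_primitive q.
rewrite (pmean_primitive ab Qq).
rewrite (@pmean_primitive _ _ _ _ (- (Q \Po ((a + b)%:P - 'X)))) //.
  rewrite !hornerE !horner_comp !hornerE.
  have -> : a + b - b = a by ring.
  have -> : a + b - a = b by ring.
  by ring.
by rewrite derivN deriv_comp Qq derivB derivC derivX sub0r mulrN1 opprK.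
Qed.

(** A primitive of [q] is nondecreasing on [a, b]; with equal values at the ends
    it would be constant there, hence everywhere. *)
Lemma pmean_gt0 (R : realType) (a b : R) (q : {poly R}) : a < b -> q != 0 ->
  (forall t, a <= t <= b -> 0 <= q.[t]) -> 0 < pmean a b q.
Proof.
move=> ab qn0 q0; have [Q Qq] := poly_primitive q.
have mono s t : a <= s -> s < t -> t <= b -> Q.[s] <= Q.[t].
  move=> sa st tb; have [x xst] := @MVT R (horner Q) (horner Q^`()) s t st
    (fun x _ => is_derive_poly _ x) (@continuous_within_horner _ _ _).
  rewrite -subr_ge0 => ->; rewrite mulr_ge0 ?subr_ge0 ?(ltW st) // Qq q0 //.
  move: xst; rewrite in_itv /= => /andP[sx xt].
  by rewrite (le_trans sa (ltW sx)) (le_trans (ltW xt) tb).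
rewrite (pmean_primitive ab Qq) mulr_gt0 ?invr_gt0 ?subr_gt0 //.
rewrite lt_def mono ?lexx // andbT; apply: contra qn0 => /eqP Qab.
have Qcst t : a < t < b -> Q.[t] = Q.[a].
  move=> /andP[ta tb]; apply/le_anti.
  by rewrite (mono a t) ?(ltW tb) // -Qab mono ?(ltW ta).
(* [size Q] distinct points of ]a, b[, more than [Q - Q.[a]] can have as roots *)
pose s := [seq a + (b - a) / k.+2%:R | k <- iota 0 (size Q)].
have Q0 : Q - Q.[a]%:P = 0.
  apply/eqP; apply/negPn/negP => Qn0.
  have : (size s < size (Q - Q.[a]%:P)%R)%N.
    apply: max_poly_roots => //.
      apply/allP => t /mapP[k _ ->]; rewrite rootE !hornerE Qcst ?subrr //.
      have k2 : 1 < k.+2%:R :> R by rewrite ltr1n.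
      have k0 : 0 < k.+2%:R :> R by rewrite ltr0n.
      rewrite ltrDl divr_gt0 ?subr_gt0 //= -ltrBrDl ltr_pdivrMr //.
      by rewrite ltr_pMr ?subr_gt0.
    have ba : b - a != 0 by rewrite subr_eq0 gt_eqF.
    rewrite map_inj_uniq ?iota_uniq // => k l /addrI/(mulfI ba)/invr_inj/eqP.
    by rewrite eqr_nat => /eqP[].
  rewrite size_map size_iota; apply/negP; rewrite -leqNgt.
  apply: (leq_trans (size_polyD _ _)).
  rewrite geq_max leqnn size_polyN size_polyC.
  case: (Q.[a] =P 0) => //= Qa; rewrite lt0n size_poly_eq0.
  by apply/eqP => Qz; apply: Qa; rewrite Qz horner0.
by rewrite -Qq -[Q](subrK (Q.[a])%:P) Q0 add0r derivC.
Qed.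

(** * Weights of Gauss-Lobatto rules *)

Lemma gauss_lobatto_nodes_lt (R : realType) (a b : R) (L : nat) (x w : nat -> R)
    (i k : nat) :
  gauss_lobatto a b L x w -> (1 <= i)%N -> (i < k)%N -> (k <= L)%N -> x i < x k.
Proof.
move=> [_ _ xlt _] i1; elim: k => [//|k IH]; rewrite ltnS leq_eqVlt.
move=> /predU1P[<- kL|ik kL]; first by apply: xlt; rewrite i1.
by apply: (lt_trans (IH ik (ltnW kL))); apply: xlt; lia.
Qed.

Lemma gauss_lobatto_ends (R : realType) (a b : R) (L : nat) (x w : nat -> R) :
  gauss_lobatto a b L x w -> [/\ (2 <= L)%N, x 1%N = a, x L = b & a < b].
Proof.
move=> GL; have [L2 [x1 xL] _ _] := GL; split=> //.
by rewrite -x1 -xL (gauss_lobatto_nodes_lt GL).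
Qed.

Lemma gauss_lobatto_single (R : realType) (a b : R) (L : nat) (x w : nat -> R)
    (q : {poly R}) (mu : nat) :
  gauss_lobatto a b L x w -> (size q <= 2 * L - 2)%N -> (1 <= mu <= L)%N ->
  (forall nu, (1 <= nu <= L)%N -> nu != mu -> q.[x nu] = 0) ->
  pmean a b q = w mu * q.[x mu].
Proof.
move=> [_ _ _ exact] sq muL q0; rewrite /pmean exact //.
rewrite (bigD1_seq mu) ?iota_uniq //=; last by rewrite mem_index_iota; lia.
rewrite big_seq_cond big1 ?addr0 // => nu /andP[].
by rewrite mem_index_iota ltnS => nuL numu; rewrite q0 ?mulr0.
Qed.

Definition inner_nodal (R : realType) (L : nat) (x : nat -> R) : {poly R} :=
  \prod_(2 <= nu < L) ('X - (x nu)%:P).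

(** The weight for which the interior nodes are those of a Gauss rule. *)
Definition bubble (R : realType) (a b : R) : {poly R} :=
  ('X - a%:P) * (b%:P - 'X).

Lemma inner_nodal_root (R : realType) (L : nat) (x : nat -> R) (nu : nat) :
  (2 <= nu < L)%N -> (inner_nodal L x).[x nu] = 0.
Proof.
move=> nuL; apply/rootP; rewrite /inner_nodal (bigD1_seq nu) ?iota_uniq //=.
  by rewrite rootM root_XsubC eqxx.
by rewrite mem_index_iota.
Qed.

Lemma inner_nodal_monic (R : realType) (L : nat) (x : nat -> R) :
  inner_nodal L x \is monic.
Proof. by apply: monic_prod => nu _; exact: monicXsubC. Qed.

Lemma size_inner_nodal (R : realType) (L : nat) (x : nat -> R) :
  (2 <= L)%N -> size (inner_nodal L x) = L.-1.
Proof.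
move=> L2; rewrite /inner_nodal size_prod_XsubC size_iota; lia.
Qed.

Lemma bubbleE (R : realType) (a b t : R) : (bubble a b).[t] = (t - a) * (b - t).
Proof. by rewrite /bubble !hornerE. Qed.

Lemma size_CsubX (R : realType) (c : R) : size (c%:P - 'X) = 2.
Proof. by rewrite -opprB size_polyN size_XsubC. Qed.

Lemma size_bubble (R : realType) (a b : R) : size (bubble a b) = 3.
Proof.
by rewrite /bubble size_monicM ?monicXsubC ?size_XsubC -?size_poly_eq0 ?size_CsubX.
Qed.

Lemma pmean_bubble_sqr_gt0 (R : realType) (a b : R) (s : {poly R}) :
  a < b -> s != 0 -> 0 < pmean a b (bubble a b * s ^+ 2).
Proof.
move=> ab s0; apply: pmean_gt0 => //.
  by rewrite mulf_neq0 ?expf_neq0 // -size_poly_eq0 size_bubble.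
move=> t /andP[at_ tb]; rewrite hornerM bubbleE horner_exp.
by rewrite mulr_ge0 ?sqr_ge0 // mulr_ge0 ?subr_ge0.
Qed.

Lemma size_mul_le (R : realType) (p q : {poly R}) (m n : nat) :
  (size p <= m.+1)%N -> (size q <= n.+1)%N -> (size (p * q)%R <= (m + n).+1)%N.
Proof.
by move=> pm qn; apply: leq_trans (size_polyMleq _ _) _; lia.
Qed.

(** The witness is the bubble times the square of the nodal polynomial of the
    other interior nodes: it is nonnegative on [a, b], vanishes at all nodes but
    [x mu], and has degree [2 L - 4], for which the rule is exact. *)
Lemma gauss_lobatto_weight_gt0 (R : realType) (a b : R) (L : nat)
    (x w : nat -> R) (mu : nat) :
  gauss_lobatto a b L x w -> (1 < mu < L)%N -> 0 < w mu.
Proof.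
move=> GL muL; have [L2 x1 xL ab] := gauss_lobatto_ends GL.
have lt_x := gauss_lobatto_nodes_lt GL.
pose s := \prod_(2 <= nu < L | nu != mu) ('X - (x nu)%:P).
have sE : inner_nodal L x = ('X - (x mu)%:P) * s.
  by rewrite /inner_nodal (bigD1_seq mu) ?iota_uniq ?mem_index_iota.
have s0 : s != 0.
  apply: contraTneq (inner_nodal_monic L x) => s0.
  by rewrite sE s0 mulr0 monicE lead_coef0 eq_sym oner_eq0.
have ss : size s = (L - 2)%N.
  have := size_inner_nodal x L2; rewrite sE size_monicM ?monicXsubC //.
  by rewrite size_XsubC subn2 => /(congr1 predn).
have sz : (size (bubble a b * s ^+ 2)%R <= 2 * L - 2)%N.
  have h : (size (s ^+ 2)%R <= (L - 3 + (L - 3)).+1)%N.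
    by rewrite expr2; apply: size_mul_le; rewrite ss; lia.
  by apply: leq_trans (@size_mul_le _ _ _ 2 _ _ h) _; rewrite ?size_bubble; lia.
have val : pmean a b (bubble a b * s ^+ 2)
    = w mu * (bubble a b * s ^+ 2).[x mu].
  apply: (gauss_lobatto_single GL sz); first by lia.
  move=> nu nuL numu; rewrite hornerM horner_exp bubbleE.
  have [->|nu1] := eqVneq nu 1%N; first by rewrite x1 subrr !mul0r.
  have [->|nL] := eqVneq nu L; first by rewrite xL subrr mulr0 mul0r.
  have /rootP -> : root s (x nu).
    rewrite rootE /s horner_prod prodf_seq_eq0; apply/hasP; exists nu.
      by rewrite mem_index_iota; lia.
    by rewrite numu !hornerE subrr eqxx.
  by rewrite expr0n mulr0.
have := pmean_bubble_sqr_gt0 ab s0; rewrite val => pos.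
have : 0 <= (bubble a b * s ^+ 2).[x mu].
  rewrite hornerM bubbleE horner_exp mulr_ge0 ?sqr_ge0 //.
  by rewrite mulr_ge0 // subr_ge0 ltW // -?x1 -?xL lt_x //; lia.
rewrite le_eqVlt => /predU1P[z|q0]; first by rewrite -z mulr0 ltxx in pos.
by rewrite pmulr_lgt0 in pos.
Qed.

Lemma comp_reflectK (R : realType) (c : R) (q : {poly R}) :
  (q \Po (c%:P - 'X)) \Po (c%:P - 'X) = q.
Proof.
rewrite -comp_polyA comp_polyB comp_polyC comp_polyX subKr.
exact: comp_polyXr.
Qed.

Lemma bubble_reflect (R : realType) (a b : R) :
  bubble a b \Po ((a + b)%:P - 'X) = bubble a b.
Proof.
rewrite /bubble comp_polyM !comp_polyB !comp_polyC comp_polyX polyCD.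
by ring.
Qed.

(** The interior nodal polynomial is orthogonal, with respect to the bubble, to
    all polynomials of smaller degree; so is its reflection. The difference of
    the two, normalised to be monic, is orthogonal to itself. *)
Lemma inner_nodal_reflect (R : realType) (a b : R) (L : nat) (x w : nat -> R) :
  gauss_lobatto a b L x w ->
  inner_nodal L x
  = (-1) ^+ L.-2 *: (inner_nodal L x \Po ((a + b)%:P - 'X)).
Proof.
move=> GL; have [L2 x1 xL ab] := gauss_lobatto_ends GL.
set N := inner_nodal L x; set rho := _%:P - 'X.
have sN : size N = L.-1 by exact: size_inner_nodal.
have srho : size rho = 2 by exact: size_CsubX.
set N' := _ *: _; apply/eqP; rewrite -subr_eq0; apply/negPn/negP => s0.
set s := N - N' in s0.
have sN' : size N' = L.-1.
  by rewrite /N' size_scale ?signr_eq0 // size_comp_poly2.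
have lN' : lead_coef N' = 1.
  rewrite /N' lead_coefZ lead_coef_comp ?srho // sN.
  rewrite (monicP (inner_nodal_monic L x)) mul1r /rho -opprB lead_coefN.
  by rewrite lead_coefXsubC -exprMn mulrNN mulr1 expr1n.
have ss : (size s <= L.-2)%N.
  apply/leq_sizeP => k kL; rewrite coefB.
  have [->|kL'] := eqVneq k L.-2.
    have := monicP (inner_nodal_monic L x).
    by move: lN'; rewrite !lead_coefE sN' sN => -> ->; rewrite subrr.
  by rewrite !nth_default ?subrr // ?sN ?sN'; lia.
have L3 : (3 <= L)%N.
  have : (0 < size s)%N by rewrite lt0n size_poly_eq0.
  by move=> /leq_trans/(_ ss); lia.
have orth (r : {poly R}) : (size r <= L.-2)%N -> pmean a b (bubble a b * (N * r)) = 0.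
  move=> sr; rewrite (@gauss_lobatto_single _ _ _ _ _ _ _ 1%N GL).
  - by rewrite hornerM bubbleE x1 subrr !mul0r mulr0.
  - have h : (size (N * r)%R <= (L - 2 + (L - 3)).+1)%N.
      by apply: size_mul_le; [rewrite sN|]; lia.
    by apply: leq_trans (@size_mul_le _ _ _ 2 _ _ h) _; rewrite ?size_bubble; lia.
  - by lia.
  - move=> nu nuL nu1; rewrite hornerM bubbleE hornerM.
    have [->|nL] := eqVneq nu L; first by rewrite xL subrr mulr0 mul0r.
    by rewrite inner_nodal_root ?mul0r ?mulr0 //; lia.
have orth' : pmean a b (bubble a b * (N' * s)) = 0.
  rewrite -(pmean_reflect _ ab) comp_polyM bubble_reflect comp_polyM /N'.
  rewrite comp_polyZ comp_reflectK -scalerAl -scalerAr pmeanZ //.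
  by rewrite orth ?mulr0 // size_comp_poly2.
have := pmean_bubble_sqr_gt0 ab s0.
have -> : bubble a b * s ^+ 2
    = bubble a b * (N * s) + (-1) *: (bubble a b * (N' * s)).
  by rewrite scaleN1r /s; ring.
by rewrite pmeanD // pmeanZ // orth // orth' mulr0 addr0 ltxx.
Qed.

(** Exactness in degree [2 L - 3] for the pair [(b - X) N^2] and [(X - a) N^2],
    where [N] is the interior nodal polynomial: each vanishes at all nodes but
    one end, and the reflection about the midpoint exchanges them. *)
Lemma gauss_lobatto_end_weights (R : realType) (a b : R) (L : nat)
    (x w : nat -> R) :
  gauss_lobatto a b L x w -> w L = w 1%N.
Proof.
move=> GL; have [L2 x1 xL ab] := gauss_lobatto_ends GL.
have lt_x := gauss_lobatto_nodes_lt GL.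
have reflN := inner_nodal_reflect GL.
set N := inner_nodal L x in reflN; set rho := _%:P - 'X in reflN.
have sN : size N = L.-1 by exact: size_inner_nodal.
have N2 : N ^+ 2 = N ^+ 2 \Po rho.
  have -> : N ^+ 2 \Po rho = (N \Po rho) ^+ 2 by rewrite !expr2 comp_polyM.
  by rewrite [in LHS]reflN exprZn sqrr_sign scale1r.
have Nb : N.[b] ^+ 2 = N.[a] ^+ 2.
  rewrite -!horner_exp [in LHS]N2 horner_comp !hornerE.
  by have -> : a + b - b = a by ring.
have Na : N.[a] != 0.
  rewrite /N /inner_nodal horner_prod prodf_seq_neq0; apply/allP => nu.
  rewrite mem_index_iota !hornerE -x1 => nuL /=.
  by rewrite subr_eq0 lt_eqF // lt_x //; lia.
have sz (c : {poly R}) : size c = 2 -> (size (c * N ^+ 2)%R <= 2 * L - 2)%N.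
  move=> sc; have h : (size (N ^+ 2)%R <= (L - 2 + (L - 2)).+1)%N.
    by rewrite expr2; apply: size_mul_le; rewrite sN; lia.
  by apply: leq_trans (@size_mul_le _ _ _ 1 _ _ h) _; rewrite ?sc; lia.
have m1 : pmean a b ((b%:P - 'X) * N ^+ 2) = w 1%N * ((b - a) * N.[a] ^+ 2).
  rewrite (@gauss_lobatto_single _ _ _ _ _ _ _ 1%N GL).
  - by rewrite hornerM horner_exp x1 hornerD hornerN hornerC hornerX.
  - by rewrite sz // size_CsubX.
  - by lia.
  - move=> nu nuL nu1; rewrite hornerM horner_exp.
    have [->|nL] := eqVneq nu L; first by rewrite xL hornerD hornerN hornerC hornerX subrr mul0r.
    by rewrite inner_nodal_root ?expr0n ?mulr0 //; lia.
have mL : pmean a b (('X - a%:P) * N ^+ 2) = w L * ((b - a) * N.[a] ^+ 2).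
  rewrite (@gauss_lobatto_single _ _ _ _ _ _ _ L GL).
  - by rewrite hornerM horner_exp xL Nb hornerXsubC.
  - by rewrite sz // size_XsubC.
  - by lia.
  - move=> nu nuL nL; rewrite hornerM horner_exp.
    have [->|nu1] := eqVneq nu 1%N; first by rewrite x1 hornerXsubC subrr mul0r.
    by rewrite inner_nodal_root ?expr0n ?mulr0 //; lia.
have : (b - a) * N.[a] ^+ 2 != 0.
  by rewrite mulf_neq0 ?expf_neq0 // subr_eq0 gt_eqF.
move/mulIf; apply; rewrite -m1 -mL -(pmean_reflect _ ab) comp_polyM -/rho -N2.
congr (pmean a b (_ * _)).
by rewrite comp_polyB comp_polyX comp_polyC /rho polyCD; ring.
Qed.

(** * Positivity of the updated cell averages *)

Lemma gauss_lobatto_weights_sum (R : realType) (a b : R) (L : nat)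
    (x w : nat -> R) :
  gauss_lobatto a b L x w ->
  w 1%N + (w L + \sum_(2 <= mu < L) w mu) = 1.
Proof.
move=> GL; have [L2 _ _ ab] := gauss_lobatto_ends GL.
have [_ _ _ /(_ 1)] := GL; rewrite size_poly1 => /(_ _)/esym.
under eq_bigr do rewrite hornerC mulr1.
rewrite big_ltn; last by lia.
rewrite big_nat_recr /= ?[_ + w L]addrC // => ->; last by lia.
rewrite -/(pmean a b 1) (@pmean_primitive _ _ _ _ 'X) ?derivX // !hornerX.
by rewrite mulVf // subr_eq0 gt_eqF.
Qed.

Lemma gauss_lobatto_mean_vec (R : realType) (a b : R) (L : nat)
    (x w : nat -> R) (P : state {poly R}) :
  gauss_lobatto a b L x w -> (forall k, (size (P 0%R k) <= 2 * L - 2)%N) ->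
  mean_vec a b P = w 1%N *: eval_vec P a
    + (w L *: eval_vec P b + \sum_(2 <= mu < L) w mu *: eval_vec P (x mu)).
Proof.
move=> GL sP; have [L2 x1 xL ab] := gauss_lobatto_ends GL.
have [_ _ _ exact] := GL.
apply/rowP => k; rewrite !mxE summxE exact ?sP //.
rewrite big_ltn; last by lia.
rewrite big_nat_recr /= ?[_ + w L * _]addrC ?x1 ?xL; last by lia.
by congr (_ + (_ + _)); apply: eq_bigr => mu _; rewrite !mxE.
Qed.

(** The update regrouped by the sign of the traces: each half of the numerical
    flux difference is absorbed by a splitting of the traces on both sides of
    the cell. *)
Lemma lf_regroup (R : realType) (a l w1 wL : R)
    (Um Up Vm Vp FUm FUp FVm FVp S : state R) : a != 0 ->
  w1 *: Vp + (wL *: Um + S)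
    - l *: (2^-1 *: (FUm + FUp - a *: (Up - Um))
            - 2^-1 *: (FVm + FVp - a *: (Vp - Vm)))
  = (a * l) *: (2^-1 *: (Um - a^-1 *: FUm + (Vm + a^-1 *: FVm)))
    + ((a * l) *: (2^-1 *: (Up - a^-1 *: FUp + (Vp + a^-1 *: FVp)))
    + ((w1 - a * l) *: Vp + ((wL - a * l) *: Um + S))).
Proof. by move=> a0; apply/rowP => k; rewrite !mxE; field. Qed.

Theorem theorem3p4 (R : realType) (p : R -> R -> R) (hp : is_eos p)
    (dx : R) (hdx : 0 < dx)
    (xh : int -> R) (hxh : forall j : int, xh j - xh (j - 1) = dx)
    (K : nat) (hK : (1 <= K)%N)
    (P : int -> state {poly R})
    (hP : forall (j : int) k, (size (P j 0%R k) <= K.+1)%N)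
    (Ubar : int -> state R)
    (hUbar : forall j : int, Ubar j = mean_vec (xh (j - 1)) (xh j) (P j))
    (L : nat) (hL : (K + 3 <= 2 * L)%N)
    (xhat : int -> nat -> R) (w : nat -> R)
    (hGL : forall j : int, gauss_lobatto (xh (j - 1)) (xh j) L (xhat j) w)
    (aLF dt : R)
    (Unew : int -> state R)
    (hscheme : forall j : int,
       Unew j = Ubar j - (dt / dx) *:
         (lf_flux p aLF (trace xh P false j) (trace xh P true j)
          - lf_flux p aLF (trace xh P false (j - 1)) (trace xh P true (j - 1))))
    (Bconst : R)
    (hB : forall (s : bool) (j : int), magnetic (trace xh P s j) 0 0 = Bconst)
    (hG : forall (j : int) (mu : nat), (1 <= mu <= L)%N ->
       admissible (eval_vec (P j) (xhat j mu)))
    (haLF : (ereal_sup [set (alpha p 0 (trace xh P z.1 z.2)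
                               (trace xh P z.1 (z.2 - 1)))%:E
                       | z in [set: bool * int]] < aLF%:E)%E)
    (hCFL : 0 < aLF * dt / dx <= w 1%N) :
  forall j : int, admissible (Unew j).
Proof.
move=> j.
have GL := hGL j; have [L2 x1 xL ab] := gauss_lobatto_ends GL.
have Gtrace s k : admissible (trace xh P s k).
  rewrite /trace; case: s.
    have [_ + _ _] := gauss_lobatto_ends (hGL (k + 1)).
    by rewrite addrK => <-; apply: hG; rewrite (ltnW L2).
  have [_ _ <- _] := gauss_lobatto_ends (hGL k).
  by apply: hG; rewrite (ltnW L2) /=.
have [/andP[c0 cw] dx0] := (hCFL, gt_eqF hdx).
have alt s : alpha p 0 (trace xh P s j) (trace xh P s (j - 1)) < aLF.
  rewrite -lte_fin; apply: le_lt_trans haLF.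
  by apply: ereal_sup_ubound; exists (s, j).
pose G s := 2^-1 *: (trace xh P s j - aLF^-1 *: flux p 0 (trace xh P s j)
  + (trace xh P s (j - 1) + aLF^-1 *: flux p 0 (trace xh P s (j - 1)))).
have GG s : admissible (G s).
  have [s0 [sE _]] := alpha_attained p 0 (Gtrace s j) (Gtrace s (j - 1)).
  apply: (@lf_splitting _ _ _ _ _ s0) => //; first by rewrite !hB.
  by rewrite -sE.
have a0 : aLF != 0.
  by apply: contraTneq c0 => ->; rewrite !mul0r ltxx.
have sP k : (size (P j 0%R k) <= 2 * L - 2)%N.
  by apply: leq_trans (hP j k) _; lia.
rewrite hscheme hUbar (gauss_lobatto_mean_vec GL sP) /lf_flux.
have -> : eval_vec (P j) (xh j) = trace xh P false j by [].
have -> : eval_vec (P j) (xh (j - 1)) = trace xh P true (j - 1).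
  by rewrite /trace subrK.
rewrite lf_regroup // -/(G false) -/(G true) mulrA.
set c := aLF * dt / dx in c0 cw *.
pose r := [:: (c, G false), (c, G true), (w 1%N - c, trace xh P true (j - 1)),
  (w L - c, trace xh P false j)
  & [seq (w mu, eval_vec (P j) (xhat j mu)) | mu <- index_iota 2 L]].
have wL := gauss_lobatto_end_weights GL.
have -> : c *: G false + (c *: G true
    + ((w 1%N - c) *: trace xh P true (j - 1)
       + ((w L - c) *: trace xh P false j
          + \sum_(2 <= mu < L) w mu *: eval_vec (P j) (xhat j mu))))
  = \sum_(z <- r) z.1 *: z.2 by rewrite !big_cons big_map.
apply: admissible_convex_sum.
- move=> z; rewrite !inE => /or4P[/eqP->|/eqP->|/eqP->|/predU1P[->|]] /=.
  + exact: ltW.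
  + exact: ltW.
  + by rewrite subr_ge0.
  + by rewrite wL subr_ge0.
  + case/mapP => mu; rewrite mem_index_iota => muL -> /=.
    by rewrite ltW // (gauss_lobatto_weight_gt0 GL).
- rewrite !big_cons big_map /= -[RHS](gauss_lobatto_weights_sum GL).
  by ring.
- move=> z; rewrite !inE => /or4P[/eqP->|/eqP->|/eqP->|/predU1P[->|]] //=.
  case/mapP => mu; rewrite mem_index_iota => muL -> /=.
  by apply: hG; lia.
Qed.
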